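(* Let $X$ be a real, separable, reflexive Banach space with dual $X'$, and let $A: X\to X'$ be a (possibly nonlinear) operator which is weakly continuous and coercive. Then for every $b\in X'$ there exists $x\in X$ with $A(x)=b$.
   Context: $\langle\cdot,\cdot\rangle$ denotes the duality pairing between $X'$ and $X$. Weakly continuous means: whenever $x_n\rightharpoonup x$ weakly in $X$ (sequences), then $A(x_n)\stackrel{*}{\rightharpoonup}A(x)$ weakly-$*$ in $X'$. Coercive means: $\displaystyle\liminf_{x\in X,\ \|x\|_X\to\infty}\frac{\langle A(x),x\rangle}{\|x\|_X}=+\infty$, i.e. for every $K>0$ there is $R>0$ such that $\langle A(x),x\rangle\ge K\|x\|_X$ for all $x\in X$ with $\|x\|_X\ge R$. *)

(* Defs.v *)
From HB Require Import structures.
From mathcomp Require Import all_boot all_order all_algebra.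
From mathcomp Require Import all_classical all_reals all_analysis.
Set Implicit Arguments.
Unset Strict Implicit.
Unset Printing Implicit Defensive.
Import Order.TTheory GRing.Theory Num.Theory.
Import numFieldNormedType.Exports.
Local Open Scope classical_set_scope.
Local Open Scope ring_scope.

Section Dual.
Context {R : realType} (X : normedModType R).

(* [R^o] is [R] seen as a module over itself; its topology is the usual one. *)
Definition cont_linear : {pred X -> R^o} :=
  [pred f : X -> R^o | `[< linear f /\ continuous f >]].

Lemma cont_linearP (f : X -> R^o) :
  reflect (linear f /\ continuous f) (f \in cont_linear).
Proof. exact: asboolP. Qed.

Record dual := Dual {
  dual_fun :> X -> R^o;
  dual_funP : dual_fun \in cont_linear }.

HB.instance Definition _ := [isSub for dual_fun].
HB.instance Definition _ := [Choice of dual by <:].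

Lemma cont_linear_submod_closed : submod_closed cont_linear.
Proof.
split.
  apply/cont_linearP; split=> [a x y /=|]; last exact: cst_continuous.
  by rewrite scaler0 addr0.
move=> a f g /cont_linearP[lf cf] /cont_linearP[lg cg].
apply/cont_linearP; split=> [b x y|x].
  rewrite /= !fctE lf lg !scalerDr !scalerA (mulrC a b) -!addrA; congr (_ + _).
  by rewrite addrCA.
apply: (@continuousD _ R^o _ (a \*: f) g); last exact: cg.
by apply: (@continuousZl_tmp _ R^o); exact: cf.
Qed.

HB.instance Definition _ :=
  GRing.isSubmodClosed.Build _ _ cont_linear cont_linear_submod_closed.
HB.instance Definition _ := [SubChoice_isSubLmodule of dual by <:].

Lemma dual_linear (f : dual) : linear f.
Proof. by have /cont_linearP[] := dual_funP f. Qed.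

Lemma dual_continuous (f : dual) : continuous f.
Proof. by have /cont_linearP[] := dual_funP f. Qed.

HB.instance Definition _ (f : dual) :=
  GRing.isLinear.Build R X R^o _ f (@dual_linear f).

Lemma dualP (f g : dual) : f =1 g -> f = g.
Proof. by move=> fg; apply/val_inj/funext. Qed.

Definition dual_norm (f : dual) : R :=
  sup [set `|f x| | x in [set x : X | `|x| <= 1]].

Lemma dual_norm_has_sup (f : dual) :
  has_sup [set `|f x| | x in [set x : X | `|x| <= 1]].
Proof.
split; first by exists `|f 0|, 0 => //=; rewrite normr0.
have := @continuous_linear_bounded _ _ _ 0 f (@dual_continuous f 0).
move=> /linear_boundedP /pinfty_ex_gt0[M M0 fM].
exists M => _ [x /= x1 <-]; rewrite (le_trans (fM x))//.
by rewrite ler_piMr// ltW.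
Qed.

Lemma dual_norm_ub (f : dual) (x : X) : `|f x| <= dual_norm f * `|x|.
Proof.
have [->|x0] := eqVneq x 0; first by rewrite linear0 !normr0 mulr0.
have nx : 0 < `|x| by rewrite normr_gt0.
rewrite -ler_pdivrMr// mulrC.
have -> : `|x|^-1 * `|f x| = `|f (`|x|^-1 *: x)|.
  by rewrite linearZ/= normrM normfV normr_id.
apply: ub_le_sup; first exact: (dual_norm_has_sup f).2.
by exists (`|x|^-1 *: x) => //=; rewrite normrZ normfV normr_id mulVf// gt_eqF.
Qed.

Lemma dual_norm_le (f : dual) (M : R) :
  (forall x : X, `|x| <= 1 -> `|f x| <= M) -> dual_norm f <= M.
Proof.
move=> fM; apply: ge_sup; first exact: (dual_norm_has_sup f).1.
by move=> _ [x x1 <-]; exact: fM.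
Qed.

Lemma dual_norm_ge0 (f : dual) : 0 <= dual_norm f.
Proof.
apply: (@le_trans _ _ `|f 0|) => //.
apply: ub_le_sup; first exact: (dual_norm_has_sup f).2.
by exists 0 => //=; rewrite normr0.
Qed.

Lemma dual_normD (f g : dual) :
  dual_norm (f + g) <= dual_norm f + dual_norm g.
Proof.
apply: dual_norm_le => x x1; rewrite (le_trans (ler_normD _ _))// lerD//.
- by rewrite (le_trans (dual_norm_ub _ _))// ler_piMr// dual_norm_ge0.
- by rewrite (le_trans (dual_norm_ub _ _))// ler_piMr// dual_norm_ge0.
Qed.

Lemma dual_normZ (a : R) (f : dual) : dual_norm (a *: f) = `|a| * dual_norm f.
Proof.
have le b (g : dual) : dual_norm (b *: g) <= `|b| * dual_norm g.
  apply: dual_norm_le => x x1; rewrite [X in `|X|]/(b * g x) normrM ler_wpM2l//.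
  by rewrite (le_trans (dual_norm_ub _ _))// ler_piMr// dual_norm_ge0.
apply/le_anti; rewrite le//=.
have [->|a0] := eqVneq a 0; first by rewrite normr0 mul0r dual_norm_ge0.
have := le a^-1 (a *: f); rewrite scalerA mulVf// scale1r normfV.
by rewrite ler_pdivlMl ?normr_gt0.
Qed.

Lemma dual_norm0_eq0 (f : dual) : dual_norm f = 0 -> f = 0.
Proof.
move=> f0; apply: dualP => x; apply/eqP; rewrite -normr_le0.
by rewrite (le_trans (dual_norm_ub f x))// f0 mul0r.
Qed.

HB.instance Definition _ := Lmodule_isNormed.Build R dual
  dual_normD dual_normZ dual_norm0_eq0.

Lemma dual_normE (f : dual) :
  `|f| = sup [set `|f x| | x in [set x : X | `|x| <= 1]].
Proof. by []. Qed.

End Dual.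

Section Reflexive.
Context {R : realType} (X : normedModType R).

Lemma evaluation_cont_linear (x : X) :
  (fun f : dual X => f x) \in @cont_linear R (dual X).
Proof.
apply/cont_linearP; split=> // f.
apply/(@cvgrPdist_le _ R^o _ (nbhs f) (nbhs_filter f)) => e e0.
have d0 : 0 < e / (`|x| + 1) by rewrite divr_gt0// ltr_wpDl.
have : \forall g \near f, `|f - g| <= e / (`|x| + 1).
  exact: (@cvgr_dist_le _ _ _ (nbhs f) (nbhs_filter f) id f (@cvg_id _ _)).
apply: filterS => g fg.
have -> : f x - g x = (f - g) x by [].
rewrite (le_trans (dual_norm_ub _ _))// (le_trans (ler_wpM2r _ fg))//.
rewrite mulrAC ler_pdivrMr ?ltr_wpDl//.
by rewrite ler_wpM2l ?ltW// ltrDl.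
Qed.

Definition bidual_embedding (x : X) : dual (dual X) :=
  Dual (evaluation_cont_linear x).

Definition reflexive_space :=
  forall phi : dual (dual X), exists x : X, bidual_embedding x = phi.

End Reflexive.

Definition separable (T : topologicalType) :=
  exists2 S : set T, countable S & dense S.

Section Operators.
Context {R : realType} {X : normedModType R}.

Definition weakly_cvg (u : X^nat) (x : X) :=
  forall f : dual X, (fun n => f (u n)) @ \oo --> f x.

Definition weakly_star_cvg (F : (dual X)^nat) (G : dual X) :=
  forall x : X, (fun n => F n x) @ \oo --> G x.

Definition weakly_continuous (A : X -> dual X) :=
  forall (u : X^nat) (x : X),
    weakly_cvg u x -> weakly_star_cvg (A \o u) (A x).

Definition coercive (A : X -> dual X) :=
  forall K : R, 0 < K ->
    exists2 r : R, 0 < r & forall x : X, r <= `|x| -> K * `|x| <= A x x.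

End Operators.

(* Main.v *)
Require Import Defs.
From mathcomp Require Import all_boot.
From mathcomp Require Import zify lra.
Set Implicit Arguments.
Unset Strict Implicit.
Unset Printing Implicit Defensive.

(** The proof is a Galerkin approximation on polytopes. Let [e] be a dense
sequence in [X]. For each [n] there is a point [u n] of the convex hull of
[0, e 0, ..., e (n-1)] at which the functional [A (u n) - b] attains its
minimum over the hull (lemma [polytope_variational]).

Comparing with the vertex [0] gives [(A (u n) - b) (u n) <= 0], which by
coercivity keeps all [u n] in one ball. In a separable reflexive space a
subsequence then converges weakly to some [x] (lemma
[bounded_weakly_cvg_subseq]), so [A (u n)] converges weakly-star to [A x] along
it, and by the uniform boundedness principle these functionals have bounded
norms. Hence the minima [(A (u n) - b) (u n)] are bounded below by a constant
[- T], and comparing with the vertex [e i] yields [(A (u n) - b) (e i) >= - T]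
for all large [n]. In the limit [A x - b] is bounded below by [- T] on a dense
set, hence everywhere, and a linear functional that is bounded below vanishes.
No limit of the pairing [A (u n) (u n)], where both factors converge only
weakly, is ever taken: the minima need only be bounded.

The finite-dimensional existence result is equivalent in strength to Brouwer's
fixed point theorem. It comes from a lemma of Scarf on finite sets carrying
several linear orders (lemma [scarf]), whose proof counts Sperner-fashion the
facets of certain sets, called primitive, modulo two. Applied to the grid points
of a simplex, coloured by a vertex at which the functional is least, Scarf's
lemma produces clusters of grid points that exhibit every colour outside the
coordinates that nearly vanish (lemma [grid_coloring]). When the mesh tends to
zero the clusters shrink to a point whose positive barycentric coordinates all
belong to minimizing vertices (lemma [polytope_equilibrium]).

Both compactness arguments take limits along an ultrafilter. For weak
compactness, the ultralimit of the values of each functional is an element of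
the bidual, which reflexivity turns into a point. A sequence is extracted from
this by testing against countably many functionals only; they exist because [X]
is separable (lemma [countable_weak_separation]). *)

(** * Scarf's lemma *)

Section PrimitiveSets.
Context (U I : finType) (r : I -> U -> nat).
Hypothesis r_inj : forall i, injective (r i).

(** Scarf's primitive sets: no [y] exceeds, in all the rankings [r i] at once,
the [r i]-lowest element of [S]. They play the role of the maximal simplices of
a triangulation. *)
Definition primitive (S : {set U}) :=
  (#|S| == #|I|) && [forall y, exists i, forall x in S, r i y <= r i x].

Definition row_minimizers (S : {set U}) (m : I -> U) :=
  forall i, m i \in S /\ forall x, x \in S -> r i (m i) <= r i x.

Lemma primitiveP (S : {set U}) :
  reflect (#|S| = #|I| /\
           forall y, exists i, forall x, x \in S -> r i y <= r i x)
          (primitive S).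
Proof.
apply: (iffP andP) => [[/eqP cS /forallP dS]|[/eqP cS dS]]; split=> //.
  by move=> y; have /existsP[i /forall_inP] := dS y; exists i.
by apply/forallP => y; apply/existsP; have [i /forall_inP] := dS y; exists i.
Qed.

Lemma row_minimizers_exist (S : {set U}) (x0 : U) :
  x0 \in S -> exists m, row_minimizers S m.
Proof.
move=> x0S; exists (fun i => [arg min_(x < x0 in S) r i x]) => i.
by case: arg_minnP.
Qed.

(** Testing the domination of [S] on an element [x] of [S] itself shows that [x]
is lowest in some ranking. So the minimizer map is onto, and equality of
cardinals makes it a bijection. *)
Lemma primitive_minimizers (S : {set U}) (m : I -> U) :
  primitive S -> row_minimizers S m -> injective m /\ m @: setT = S.
Proof.
move=> /primitiveP[cS dS] mS.
have sub : S \subset m @: setT.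
  apply/subsetP => x xS; have [i iP] := dS x; have [miS mi] := mS i.
  apply/imsetP; exists i => //; apply: (@r_inj i); apply/eqP.
  by rewrite eqn_leq iP// mi.
have mST : m @: setT = S.
  apply/esym/eqP; rewrite eqEcard sub cS -cardsT; exact: leq_imset_card.
split=> //; have : #|m @: setT| == #|[set: I]| by rewrite mST cS cardsT.
by move=> /imset_injP mi i j; apply: mi.
Qed.

Section Completions.
Context (W : {set U}) (m : I -> U).
Hypothesis mW : row_minimizers W m.

Definition completions := [set x | (x \notin W) && primitive (x |: W)].

(** The new element [x] is the lowest of [x |: W] in exactly one ranking [k]; in
the others the minimizer is that of [W]. Therefore [m] restricted to the
complement of [k] is a bijection onto [W], which nearly determines [k]. *)
Lemma completion_replaces (x : U) : x \in completions ->
  exists k, [/\ forall z, z \in W -> r k x <= r k z,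
    forall l, l != k -> r l (m l) < r l x,
    forall a b, a != k -> b != k -> m a = m b -> a = b &
    forall z, z \in W -> exists2 l, l != k & z = m l].
Proof.
rewrite inE => /andP[xW xprim].
have [m' m'P] := row_minimizers_exist (setU11 x W).
have [m'inj m'im] := primitive_minimizers xprim m'P.
have /imsetP[k _ xk] : x \in m' @: setT by rewrite m'im setU11.
have m'm l : l != k -> m' l = m l.
  move=> lk; have [m'l m'le] := m'P l; have [ml mle] := mW l.
  apply: (@r_inj l); apply/eqP; rewrite eqn_leq m'le ?setU1r// mle//.
  move: m'l; rewrite in_setU1 => /orP[/eqP m'lx|//].
  by move: lk; rewrite (m'inj l k) ?eqxx// m'lx.
exists k; split.
- by move=> z zW; have [_] := m'P k; rewrite -xk; apply; rewrite setU1r.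
- move=> l lk; have [_ m'le] := m'P l.
  rewrite ltn_neqAle -m'm// m'le ?setU11// andbT.
  apply/eqP => /r_inj /esym xl; move: xW.
  by rewrite xl m'm//; have [->] := mW l.
- by move=> a b ak bk; rewrite -!m'm//; exact: m'inj.
- move=> z zW; have /imsetP[l _ zl] : z \in m' @: setT by rewrite m'im setU1r.
  have lk : l != k by apply: contraNneq xW => lk; rewrite xk -lk -zl.
  by exists l => //; rewrite -m'm.
Qed.

(** Domination of [x |: W], tested on [z], can only be witnessed by [k]. Thus a
completion that takes over ranking [k] is [k]-maximal among the elements above
[m] elsewhere, which makes it unique. *)
Lemma completion_replaces_le (k : I) (x z : U) :
  x \in completions -> (forall l, l != k -> r l (m l) < r l z) ->
  r k z <= r k x.
Proof.
rewrite inE => /andP[_ /primitiveP[_ /(_ z)[i iP]]] zk.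
have [<-|/zk] := eqVneq i k; first by apply: iP; rewrite setU11.
by rewrite ltnNge iP// setU1r//; have [] := mW i.
Qed.

(** A facet lies in no maximal simplex or in two. A completion [x] replaces the
minimizer of one ranking [k]; since [m] has exactly one collision
[m k = m j], the only other ranking that can be taken over is [j]. The
[j]-maximal element above [m] in all other rankings exists by the last
hypothesis, and is a second completion. *)
Lemma completions_even (t : U) : t \in W ->
    (forall i, exists y, forall l, l != i -> r l t < r l y) ->
  2 %| #|completions|.
Proof.
move=> tW slack.
have [->|[x xB]] := set_0Vmem completions; first by rewrite cards0.
have [k [xk xgt minj msurj]] := completion_replaces xB.
have [j jk mjk] := msurj _ (mW k).1.
pose M := [pred y | [forall (l | l != j), r l (m l) < r l y]].
have [y0 y0P] := slack j.
have y0M : M y0.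
  apply/forall_inP => l lj; apply: leq_ltn_trans (y0P l lj).
  by have [_] := mW l; apply.
pose x' := [arg max_(y > y0 | M y) r j y].
have [x'M x'max] : M x' /\ forall y, M y -> r j y <= r j x'.
  by rewrite /x'; case: arg_maxnP.
have {}x'M l : l != j -> r l (m l) < r l x' by move/(forall_inP x'M).
have x'j : forall z, z \in W -> r j x' <= r j z.
  move: (xB); rewrite inE => /andP[_ /primitiveP[_ /(_ x')[i iP]]].
  have [<- z zW|/x'M] := eqVneq i j; first by rewrite iP// setU1r.
  by rewrite ltnNge iP// setU1r//; have [] := mW i.
have x'W : x' \notin W.
  apply/negP => /msurj[l lk x'l].
  have [lj|lj] := eqVneq l j.
    by have := x'M k; rewrite eq_sym jk x'l lj -mjk ltnn; move/(_ isT).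
  by have := x'M l lj; rewrite -x'l ltnn.
have x'B : x' \in completions.
  rewrite inE x'W; apply/primitiveP; split.
    move: (xB); rewrite inE => /andP[xW /primitiveP[<- _]].
    by rewrite !cardsU1 xW x'W.
  move=> y; have [yM|] := boolP (M y).
    exists j => z; rewrite in_setU1 => /orP[/eqP->|/x'j]; first exact: x'max.
    by apply: leq_trans; exact: x'max.
  rewrite negb_forall_in => /exists_inP[l lj]; rewrite -leqNgt => yl.
  exists l => z; rewrite in_setU1 => /orP[/eqP->|zW].
    by rewrite (leq_trans yl)// ltnW// x'M.
  by rewrite (leq_trans yl)//; have [_] := mW l; apply.
have xx' : x != x'.
  apply/eqP => xx'; have := x'M k; rewrite eq_sym jk => /(_ isT).
  by rewrite ltnNge -xx' xk//; have [] := mW k.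
suff -> : completions = [set x; x'] by rewrite cards2 xx'.
apply/setP => z; rewrite in_set2; apply/idP/orP => [zB|[/eqP->|/eqP->]//].
(* The ranking taken over by any completion is one of the two colliding ones. *)
have [k' [_ zgt zinj zsurj]] := completion_replaces zB.
have [j' j'k' mj'k'] := zsurj _ (mW k').1.
have : (k' == k) || (k' == j).
  have [//|k'k] := eqVneq k' k; apply/eqP; apply: (minj k' j) => //.
  have [j'k|j'k] := eqVneq j' k; first by rewrite mj'k' j'k.
  by move: j'k'; rewrite (minj k' j') ?eqxx.
case/orP => /eqP kk; [left|right]; apply/eqP; apply: (@r_inj k'); apply/eqP;
  rewrite eqn_leq !completion_replaces_le// => l; rewrite kk.
- exact: xgt.
- exact: x'M.
Qed.

End Completions.

(** If removing [x] from [S] leaves exactly the colours other than [i0] and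
[S] itself misses a colour, then [x] shares its colour with exactly one other
element of [S], and these two are the only possible removals. *)
Lemma deletions_even (c : U -> I) (i0 : I) (S : {set U}) :
  #|S| = #|I| -> c @: S <> setT ->
  2 %| #|[set x in S | c @: (S :\ x) == ~: [set i0]]|.
Proof.
move=> cS cST; set D := [set x in S | _].
have [->|[x]] := set_0Vmem D; first by rewrite cards0.
rewrite inE => /andP[xS /eqP xD].
have cx : c x != i0.
  apply/eqP => cx; apply: cST; rewrite -(setD1K xS) imsetU1 xD cx.
  exact: setUCr.
have /imsetP[x' x'S cxx'] : c x \in c @: (S :\ x) by rewrite xD !inE.
have cinj : {in S :\ x &, injective c}.
  apply/imset_injP; rewrite xD cardsC1 -cS; apply/eqP.
  by rewrite (cardsD1 x S) xS.
move: (x'S); rewrite !inE => /andP[x'x x'S1].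
suff -> : D = [set x; x'] by rewrite cards2 eq_sym x'x.
apply/setP => y; rewrite !inE; apply/andP/orP; last first.
  case=> /eqP->; split=> //; first by rewrite xD.
  rewrite -xD; apply/eqP/setP => i; apply/imsetP/imsetP => -[z].
    rewrite !inE => /andP[zx' zS] ->.
    have [->|zx] := eqVneq z x; first by exists x' => //; rewrite !inE x'x.
    by exists z => //; rewrite !inE zx.
  rewrite !inE => /andP[zx zS] ->.
  have [->|zx'] := eqVneq z x'.
    by exists x; rewrite ?cxx'// !inE eq_sym x'x.
  by exists z => //; rewrite !inE zx'.
move=> [yS /eqP yD].
have [yx|yx] := eqVneq y x; [by left|right].
have : c y \in c @: (S :\ y).
  by rewrite yD -xD; apply/imsetP; exists y => //; rewrite !inE yx.
move=> /imsetP[z]; rewrite !inE => /andP[zy zS] cyz.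
have [zx|zx] := eqVneq z x.
  by apply/eqP; apply: cinj; rewrite ?inE ?yx ?x'x// cyz zx.
by move: zy; rewrite (cinj z y) ?inE ?zx ?yx ?eqxx.
Qed.

(** Double counting of the incidences between a set and the set with one more
element. *)
Lemma sum_deletions_completions (P Q : pred {set U}) :
  \sum_(S | P S) #|[set x in S | Q (S :\ x)]| =
  \sum_(W | Q W) #|[set x | (x \notin W) && P (x |: W)]|.
Proof.
transitivity
  (\sum_(x : U) \sum_(S : {set U} | [&& x \in S, P S & Q (S :\ x)]) 1).
  under eq_bigr do rewrite -sum1_card.
  rewrite (exchange_big_dep predT)//=.
  apply: eq_bigr => x _; apply: eq_bigl => S.
  by rewrite inE andbCA.
transitivity
  (\sum_(x : U) \sum_(W : {set U} | [&& x \notin W, Q W & P (x |: W)]) 1).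
  apply: eq_bigr => x _.
  rewrite (reindex_onto (fun W => x |: W) (fun S => S :\ x)); last first.
    by move=> S /andP[xS _]; exact: setD1K.
  apply: eq_bigl => W; rewrite setU11/=.
  have [xW|xW] := boolP (x \in W).
    apply/negbTE; rewrite negb_and; apply/orP; right.
    by apply/eqP => /setP/(_ x); rewrite !inE eqxx xW.
  by rewrite setU1K// eqxx andbT andbC.
under [RHS]eq_bigr do rewrite -sum1_card.
rewrite [RHS](exchange_big_dep predT)//=; apply: eq_bigr => x _.
by apply: eq_bigl => W; rewrite inE andbCA.
Qed.

End PrimitiveSets.

(** The elements [inr i] are slack elements, corresponding to the faces of a
simplex: [inr i] is lowest for [i] and above all of [T] for the other
rankings. Count the pairs of a primitive set and one of its elements whose
removal leaves exactly the colours other than [i0]. Without a primitive set of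
all colours the count over primitive sets is even. Count again over the sets
left by the removal, the facets. By [completions_even] a facet containing some
[inl t] contributes an even number, because [inr i] lies above [inl t] in all
rankings but [i]. The one remaining facet consists of the slack elements other
than [inr i0]; its only completion is the [i0]-largest element of [T], so that
the count is odd. *)
Lemma rainbow_primitive (T I : finType) (r : I -> T + I -> nat)
    (c : T + I -> I) (t0 : T) :
    (forall i, injective (r i)) ->
    (forall i u, r i (inr i) <= r i u) ->
    (forall i j t, i != j -> r i (inl t) < r i (inr j)) ->
    (forall i, c (inr i) = i) ->
  exists2 S, primitive r S & c @: S = setT.
Proof.
move=> r_inj rlow rhigh cI.
have [/existsP[S /andP[Sp /eqP Sc]]|/existsPn none] :=
  boolP [exists S, primitive r S && (c @: S == setT)]; first by exists S.
exfalso; pose i0 := c (inl t0); pose W0 : {set T + I} := inr @: (~: [set i0]).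
pose good := [pred W : {set T + I} | c @: W == ~: [set i0]].
have even_total :
    2 %| \sum_(S | primitive r S) #|[set x in S | good (S :\ x)]|.
  apply: dvdn_sum => S Sp; apply: deletions_even.
    by have /primitiveP[] := Sp.
  by move=> Sc; have := none S; rewrite Sp Sc eqxx.
have not_low i t (S : {set T + I}) : inr i \in S ->
    ~ forall x, x \in S -> r i (inl t) <= r i x.
  move=> iS /(_ _ iS) tle; suff: inl t = inr i by [].
  by apply: (r_inj i); apply/eqP; rewrite eqn_leq tle rlow.
have W0good : good W0.
  apply/eqP/setP => i; apply/imsetP/idP => [[_ /imsetP[j jP ->] ->]|iP].
    by rewrite cI.
  by exists (inr i); rewrite ?cI//; apply/imsetP; exists i.
have W0one : #|completions r W0| = 1.
  pose tm := [arg max_(t > t0) r i0 (inl t)].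
  have tmP t : r i0 (inl t) <= r i0 (inl tm).
    by rewrite /tm; case: arg_maxnP => // t1 _; apply.
  have inlW0 t : inl t \notin W0 by apply/imsetP => -[].
  suff -> : completions r W0 = [set inl tm] by rewrite cards1.
  apply/setP => x; rewrite !inE; apply/andP/eqP => [[xW0 /primitiveP[_ xP]]|->].
    have [i iP] := xP (inl tm).
    have iW0 : inr i \notin x |: W0.
      by apply/negP => iS; exact: (not_low i tm _ iS iP).
    have ii0 : i = i0.
      apply/eqP; apply: contraNT iW0 => ii0; rewrite setU1r//.
      by apply/imsetP; exists i => //; rewrite !inE.
    case: x xW0 xP iP iW0 => [t|j] xW0 xP iP iW0.
      apply: (r_inj i0); apply/eqP; rewrite eqn_leq tmP/=.
      by rewrite -{1}ii0 -ii0 iP// setU11.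
    move: iW0; rewrite ii0 !inE; have [->|ji0] := eqVneq j i0.
      by rewrite eqxx.
    by move: xW0; rewrite (imset_f inr)// !inE.
  split=> //; apply/primitiveP; split.
    rewrite cardsU1 inlW0 card_imset; last by move=> ? ? [].
    by rewrite cardsC1 add1n prednK//; apply/card_gt0P; exists i0.
  case=> [t|i]; last by exists i => z _.
  exists i0 => z; rewrite in_setU1 => /orP[/eqP->//|/imsetP[j]].
  by rewrite !inE => ji0 ->; rewrite ltnW// rhigh// eq_sym.
have even_rest : 2 %| \sum_(W | good W && (W != W0)) #|completions r W|.
  apply: dvdn_sum => W /andP[/eqP Wgood WW0].
  have [t tW] : exists t, inl t \in W.
    apply/existsP; apply: contraR WW0; rewrite negb_exists => /forallP noT.
    apply/eqP/setP => x; apply/idP/imsetP => [|[i + ->]].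
      case: x => [t|i iW]; first by rewrite (negbTE (noT t)).
      by exists i => //; rewrite -Wgood -(cI i); exact: imset_f.
    rewrite -Wgood => /imsetP[[t tW|j jW]]; first by have := noT t; rewrite tW.
    by rewrite cI => ->.
  have [m mP] := row_minimizers_exist r tW.
  apply: (completions_even r_inj mP tW) => i.
  by exists (inr i) => l li; exact: rhigh.
move: even_total; rewrite sum_deletions_completions (bigD1 W0)//=.
by rewrite -/(completions _ _) W0one dvdn_addl.
Qed.

(** Ties of [p i] are broken by an arbitrary enumeration of [T], and slack
elements are added at the bottom and at the top. In a primitive set of all
colours, the set [C] of the colours whose slack element is absent is the one
sought: a slack element in the set dominates nothing in its own ranking, so
domination must come from [C]. *)
Lemma scarf (T I : finType) (p : I -> T -> nat) (c : T -> I) (t0 : T) :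
  exists (C : {set I}) (w : I -> T), (forall i, i \in C -> c (w i) = i) /\
    forall y, exists2 i, i \in C & forall j, j \in C -> p i y <= p i (w j).
Proof.
pose K := #|T|; pose top i := (\max_t p i t).+1 * K.
pose r i (u : T + I) := match u with
  | inl t => (p i t * K + enum_rank t).+1
  | inr j => if j == i then 0 else (top i + enum_rank j).+1
  end.
have rank_lt (t : T) : enum_rank t < K by exact: ltn_ord.
have rtop i t : p i t * K + enum_rank t < top i.
  rewrite (@leq_trans ((p i t).+1 * K))//.
    by rewrite mulSn addnC ltn_add2r.
  by rewrite leq_mul2r ltnS (leq_bigmax t) orbT.
have r_inj i : injective (r i).
  move=> [t|j] [t'|j'] //=.
  - move=> [] /(congr1 (modn^~ K)); rewrite !modnMDl !modn_small//.
    by move=> /val_inj /enum_rank_inj ->.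
  - case: ifP => // _ [] tj; have := rtop i t; rewrite tj.
    by rewrite ltnNge leq_addr.
  - case: ifP => // _ [] tj; have := rtop i t'; rewrite -tj.
    by rewrite ltnNge leq_addr.
  - case: eqVneq => [->|_]; case: eqVneq => [->//|_] // [].
    by move=> /addnI /val_inj /enum_rank_inj ->.
pose c' (u : T + I) := match u with inl t => c t | inr i => i end.
have [||//|S /primitiveP[_ Sdom] Sc] := @rainbow_primitive T I r c' t0 r_inj.
- by move=> i u; rewrite /= eqxx.
- move=> i j t ij; rewrite /= eq_sym (negbTE ij) ltnS.
  by rewrite (leq_trans (rtop i t))// leq_addr.
pose C := [set i | inr i \notin S].
have [w wP] : exists w, forall i, i \in C -> inl (w i) \in S /\ c (w i) = i.
  apply: (@fin_all_exists _ _ (fun i t => i \in C -> inl t \in S /\ c t = i)).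
  move=> i; have : i \in c' @: S by rewrite Sc.
  case/imsetP => -[t tS ->|j jS ->]; first by exists t.
  by exists t0; rewrite inE jS.
exists C, w; split=> [i /wP[]//|y]; have [i iP] := Sdom (inl y).
exists i; first by rewrite inE; apply/negP => /iP; rewrite /= eqxx.
move=> j /wP[/iP/= + _]; rewrite ltnS leqNgt => le; rewrite leqNgt.
apply: contra le => lt; rewrite (@leq_trans ((p i (w j)).+1 * K))//.
  by rewrite mulSn addnC ltn_add2r.
by rewrite (leq_trans _ (leq_addr _ _))// leq_mul2r lt orbT.
Qed.

(** * Colourings of a simplicial grid *)

(** Rank the grid points of the simplex of size [N] by their coordinates. Let
[q i] be the least [i]-th coordinate of the points [w j] given by [scarf], for
[i] in [C]. If the numbers [q i + 1] had sum at most [N], a grid point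
exceeding every [q i] would contradict domination. So the points [w j], whose
coordinates are at least [q i] and sum to [N], leave these bounds by less than
[#|I|] in total: they are close to each other, and their coordinates outside
[C] are small. *)
Lemma grid_coloring (I : finType) (c : (I -> nat) -> I) (N : nat) :
  exists x : I -> nat, \sum_i x i = N /\
    forall i, x i < #|I| \/
      exists y : I -> nat, [/\ \sum_i y i = N, c y = i &
        forall k, y k <= x k + #|I| /\ x k <= y k + #|I|].
Proof.
pose T := {x : {ffun I -> 'I_N.+1} | \sum_i x i == N}.
pose p (i : I) (t : T) : nat := val t i.
have sum_p (t : T) : \sum_i p i t = N by apply/eqP; exact: (valP t).
have grid (f : I -> nat) : \sum_i f i = N ->
    exists t : T, forall i, p i t = f i.
  move=> fN; have fle i : f i < N.+1 by rewrite ltnS -fN (bigD1 i)//= leq_addr.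
  have gP : \sum_i [ffun i => Ordinal (fle i)] i == N.
    by apply/eqP; rewrite -[RHS]fN; apply: eq_bigr => i _; rewrite ffunE.
  by exists (Sub [ffun i => Ordinal (fle i)] gP) => i; rewrite /p /= ffunE.
pose i0 := c (fun=> 0).
have [|t0 _] := grid (fun i => if i == i0 then N else 0).
  by rewrite -big_mkcond big_pred1_eq.
have [C [w [wC Cdom]]] := scarf p (fun t : T => c (p^~ t)) t0.
have [i1 i1C _] := Cdom t0.
have [m mP] : exists m, forall i,
    (forall j, j \in C -> p i (w (m i)) <= p i (w j)) /\ m i \in C.
  exists (fun i => [arg min_(j < i1 in C) p i (w j)]) => i.
  by case: arg_minnP.
pose q i := if i \in C then p i (w (m i)) else 0.
have q_le i j : j \in C -> q i <= p i (w j).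
  by move=> jC; rewrite /q; case: ifP => // _; have [->] := mP i.
have q_sum : N < \sum_i q i + #|I|.
  apply: (@leq_trans (\sum_i q i + #|C|)); last by rewrite leq_add2l max_card.
  rewrite ltnNge; apply/negP => qN.
  (* The excess is put on the coordinate [i1], just to reach the sum [N]. *)
  pose f i := q i + (if i \in C then 1 else 0) +
    (if i == i1 then N - (\sum_i q i + #|C|) else 0).
  have [|y yP] := grid f.
    rewrite /f !big_split/=.
    have -> : \sum_i (if i \in C then 1 else 0) = #|C|.
      by rewrite -big_mkcond sum1_card.
    have pt z : \sum_i (if i == i1 then z else 0) = z.
      by rewrite -big_mkcond big_pred1_eq.
    by rewrite pt subnKC.
  have [i iC /(_ _ (mP i).2)] := Cdom y.
  by rewrite yP /f /q iC addn1 addSn ltnNge leq_addr.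
have q_gt i j : j \in C -> p i (w j) < q i + #|I|.
  move=> jC; have := q_sum; rewrite -(sum_p (w j)).
  rewrite (bigD1 i)//= [in X in _ < X](bigD1 i)//=.
  have : \sum_(k | k != i) q k <= \sum_(k | k != i) p k (w j).
    by apply: leq_sum => k _; exact: q_le.
  lia.
exists (p^~ (w i1)); split=> // i.
have [iC|iC] := boolP (i \in C); last first.
  by left; have := q_gt i _ i1C; rewrite /q (negbTE iC).
right; exists (p^~ (w i)); split=> //; first exact: wC.
move=> k; move: (q_gt k _ i1C) (q_gt k _ iC) (q_le k _ i1C) (q_le k _ iC).
by lia.
Qed.

(** * Limits along ultrafilters *)

From HB Require Import structures.
From mathcomp Require Import all_order all_algebra.
From mathcomp Require Import all_classical all_reals all_analysis.
Import Order.TTheory GRing.Theory Num.Theory.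
Import numFieldNormedType.Exports.
Local Open Scope classical_set_scope.
Local Open Scope ring_scope.

Lemma ultra_fmap (S T : Type) (U : set_system S) (f : S -> T) :
  UltraFilter U -> UltraFilter (f @ U).
Proof.
move=> UU; split; first exact: fmap_proper_filter.
move=> G GF UG; apply/seteqP; split=> // A GA.
have [//|nA] := in_ultra_setVsetC (f @^-1` A) UU.
have : G (A `&` ~` A) by apply: filterI => //; exact: UG.
by rewrite setICr => /filter_not_empty.
Qed.

Lemma ultra_bounded_cvg (R : realType) (S : Type) (U : set_system S)
    (f : S -> R) (M : R) :
  UltraFilter U -> (forall s, `|f s| <= M) -> exists l : R, f @ U --> l.
Proof.
move=> UU fM; have := @segment_compact R (- M) M; rewrite compact_ultra /=.
move=> cpt; have [|l [_ fl]] := cpt (f @ U) (ultra_fmap f UU); last by exists l.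
by apply: (@filterE _ U) => s /=; rewrite in_itv/= -ler_norml. 
Qed.

(** * Variational inequalities on polytopes *)

Lemma seq_continuous (R : realType) (X : normedModType R) (f : X -> R) :
  (forall (u : X^nat) x, u @ \oo --> x -> f \o u @ \oo --> f x) -> continuous f.
Proof.
move=> fseq x; apply/cvgrPdist_lt => e e0; apply: contrapT => fx.
have /choice[u uP] : forall n : nat, exists y : X,
    `|x - y| < n.+1%:R^-1 /\ e <= `|f x - f y|.
  move=> n; apply: contrapT => /forallNP far; apply: fx.
  apply/nbhs_normP; exists n.+1%:R^-1 => /=; first by rewrite invr_gt0.
  by move=> y /= xy; rewrite ltNge; apply/negP => fxy; exact: (far y).
have ux : u @ \oo --> x.
  apply/cvgrPdist_lt => d d0.
  have /cvgrPdist_lt/(_ _ d0) := @cvg_harmonic R.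
  apply: filterS => n; rewrite sub0r normrN ger0_norm ?harmonic_ge0// => nd.
  exact: lt_trans (uP n).1 nd.
have /cvgrPdist_lt/(_ _ e0)[n _ /(_ n (leqnn n))/=] := fseq _ _ ux.
by rewrite ltNge (uP n).2.
Qed.

(** Colour the grid points of barycentric coordinates by a vertex [i] that
minimizes [h i], and let the mesh tend to zero along an ultrafilter, so that the
coordinates converge. For each [i] one of the two alternatives of
[grid_coloring] holds on a set of the ultrafilter: either the [i]-th coordinate
tends to [0], or nearby points of colour [i] converge to the same limit, where
the minimality of [h i] persists by continuity. *)
Lemma polytope_equilibrium (R : realType) (X : normedModType R) (I : finType)
    (i0 : I) (v : I -> X) (h : I -> X -> R) :
    (forall i, continuous (h i)) ->
  exists a : I -> R, [/\ forall i, 0 <= a i, \sum_i a i = 1 &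
    let x := \sum_i a i *: v i in forall i, a i = 0 \/ forall j, h i x <= h j x].
Proof.
move=> hcont; pose wt N (x : I -> nat) i : R := (x i)%:R / N.+1%:R.
pose pt N x := \sum_i wt N x i *: v i.
pose c N x := [arg min_(j < i0) h j (pt N x)]%O.
have /choice[x xP] := fun N => grid_coloring (c N) N.+1.
have xsum N := (xP N).1.
have /choice[y yP] : forall Ni : nat * I, exists y : I -> nat,
    (x Ni.1 Ni.2 < #|I|)%N \/
    c Ni.1 y = Ni.2 /\
      forall k, (y k <= x Ni.1 k + #|I| /\ x Ni.1 k <= y k + #|I|)%N.
  move=> [N i] /=; have [xi|[y [_ yi yP]]] := (xP N).2 i; last first.
    by exists y; right.
  by exists (x N); left.
have wt_ge0 N z i : 0 <= wt N z i by rewrite /wt divr_ge0.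
have wt_sum N z : (\sum_i z i = N.+1)%N -> \sum_i wt N z i = 1.
  by move=> zN; rewrite -mulr_suml -natr_sum zN divff// pnatr_eq0.
have [U [UU ooU]] := @ultraFilterLemma _ \oo _.
have /choice[a aP] : forall i, exists l : R, wt N (x N) i @[N --> U] --> l.
  move=> i; apply: (@ultra_bounded_cvg _ _ _ _ 1) => N.
  rewrite ger0_norm// -(wt_sum N _ (xsum N)) (bigD1 i)//= lerDl.
  exact: sumr_ge0.
(* [#|I|] grid steps, the distance allowed by [grid_coloring]. *)
have small : #|I|%:R / N.+1%:R @[N --> U] --> (0 : R).
  apply: (cvg_trans (cvg_app _ ooU)).
  rewrite -[X in _ --> X](mulr0 (#|I|%:R : R)).
  by apply: cvgMr; exact: cvg_harmonic.
have a_ge0 i : 0 <= a i.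
  by apply: (cvgr_to_ge (aP i)); apply: filterE => N; exact: wt_ge0.
exists a; split=> //.
  have : \sum_i wt N (x N) i @[N --> U] --> \sum_i a i.
    by apply: cvg_big => [|i _]; [exact: add_continuous|exact: aP].
  under eq_fun do rewrite wt_sum//.
  by move=> /cvg_lim <-//; rewrite lim_cst.
move=> p i; have [xi|xi] := in_ultra_setVsetC [set N | (x N i < #|I|)%N] UU.
  left; apply/le_anti; rewrite a_ge0 andbT.
  apply: (ler_cvg_to (aP i) small); apply: filterS xi => N /= xi.
  by rewrite ler_wpM2r// ler_nat ltnW.
right=> j; have yP' : \forall N \near U, 
    c N (y (N, i)) = i /\
      forall k, (y (N, i) k <= x N k + #|I| /\ x N k <= y (N, i) k + #|I|)%N.
  by apply: filterS xi => N /= xi; have [/xi|] := yP (N, i).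
have yp : pt N (y (N, i)) @[N --> U] --> p.
  apply: cvg_big => [|k _]; first exact: add_continuous.
  apply: cvgZl; apply/cvgrPdist_lt => e e0.
  have e20 : 0 < e / 2 by rewrite divr_gt0.
  have /cvgrPdist_lt/(_ _ e20) := aP k.
  have /cvgrPdist_lt/(_ _ e20) := small.
  apply: filterS3 yP' => N [_ /(_ k)[yx xy]].
  rewrite sub0r normrN ger0_norm ?divr_ge0// => lts lta.
  rewrite (splitr e) -(subrKA (wt N (x N) k)).
  rewrite (le_lt_trans (ler_normD _ _))// ltrD// (le_lt_trans _ lts)//.
  rewrite -mulrBl normrM [X in _ * X]ger0_norm ?invr_ge0// ler_wpM2r ?invr_ge0//.
  by rewrite ler_distl lerBlDr -!natrD !ler_nat yx.
have hy k : h k (pt N (y (N, i))) @[N --> U] --> h k p.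
  exact: (cvg_comp _ _ yp (hcont k p)).
apply: (ler_cvg_to (hy i) (hy j)); apply: filterS yP' => N [cN _].
rewrite -{1}cN /c; case: arg_minP => // k _; exact.
Qed.

(** At the equilibrium point [x], the vertices carrying positive weight minimize
the functional [B x] among all vertices; averaging over them gives [B x x]. *)
Lemma polytope_variational (R : realType) (X : normedModType R) (I : finType)
    (i0 : I) (v : I -> X) (B : X -> dual X) :
    (forall i, continuous (fun x => B x (v i) : R)) ->
  exists x, forall j, B x x <= B x (v j).
Proof.
move=> Bcont.
have [a [a_ge0 a_sum aP]] :=
  @polytope_equilibrium _ _ _ i0 v (fun i x => B x (v i)) Bcont.
exists (\sum_i a i *: v i) => j; set x := \sum_i _ in aP *.
rewrite {2}/x linear_sum -[leRHS]mul1r -a_sum mulr_suml; apply: ler_sum => i _.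
rewrite linearZ/=; have [->|le_i] := aP i; first by rewrite scale0r mul0r.
exact: ler_wpM2l.
Qed.

(** * Weak sequential compactness *)

(** The limits of [f (u s)] depend linearly and boundedly on [f], hence define
an element of the bidual; reflexivity represents it by a point. *)
Lemma ultra_weak_limit (R : realType) (X : normedModType R) (S : Type)
    (U : set_system S) (u : S -> X) (M : R) :
    reflexive_space X -> UltraFilter U -> (forall s, `|u s| <= M) ->
  exists x : X, forall f : dual X, (f (u s) : R) @[s --> U] --> (f x : R).
Proof.
move=> Xrefl UU uM.
have bnd (f : dual X) s : `|f (u s)| <= `|f| * M.
  by rewrite (le_trans (dual_norm_ub _ _))// ler_wpM2l// dual_norm_ge0.
have /choice[phi phiP] : forall f : dual X, exists l : R,
    (f (u s) : R) @[s --> U] --> l.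
  by move=> f; apply: ultra_bounded_cvg (bnd f).
have phi_linear : linear (phi : dual X -> R^o).
  move=> a f g; apply: (@cvg_unique R _ _ _ _ _ (phiP _)) => //.
  by apply: cvgD; [apply: cvgMr; exact: phiP|exact: phiP].
have phi_le (f : dual X) : `|phi f| <= `|f| * M.
  apply: (cvgr_to_le (cvg_norm (phiP f))).
  by apply: (@filterE _ U) => s; exact: bnd.
pose Phi : {linear dual X -> R^o} := HB.pack (phi : dual X -> R^o)
  (GRing.isLinear.Build _ _ _ _ (phi : dual X -> R^o) phi_linear).
have phi_dual : (phi : dual X -> R^o) \in @cont_linear R (dual X).
  apply/cont_linearP; split=> //.
  apply: (linear_bounded_continuous Phi).1; apply/linear_boundedP.
  exists M; split; first exact: num_real.
  move=> r Mr f; rewrite (le_trans (phi_le f))// mulrC ler_wpM2r// ltW//.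
have [x xphi] := Xrefl (Dual phi_dual).
exists x => f; have -> : f x = phi f.
  by have := congr1 (fun g => dual_fun g f) xphi.
exact: phiP.
Qed.

Lemma separable_dense_seq (T : ptopologicalType) :
  separable T -> exists e : nat -> T, dense (range e).
Proof.
move=> [S /pcard_surjP[e eS] Sd]; exists e => O O0 Oo.
have [x [Ox Sx]] := Sd _ O0 Oo; exists x; split=> //.
by have [n _ <-] := eS x Sx; exists n.
Qed.

Lemma dense_norm (R : realType) (X : normedModType R) (D : set X) :
  dense D -> forall (x : X) (d : R), 0 < d -> exists2 y, D y & `|x - y| < d.
Proof.
move=> Dd x d d0; have [|y [xy Dy]] := Dd (ball x d) _ (ball_open _ _).
  by exists x; exact: ballxx.
by exists y => //; move: xy; rewrite -ball_normE.
Qed.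

(** A positive supremum of [`|g x|] over the dual unit ball exceeds its half, so
some [f] of the ball reaches that half. *)
Lemma half_norming (R : realType) (X : normedModType R) (x : X) :
  exists f : dual X, `|f| <= 1 /\
    forall g : dual X, `|g| <= 1 -> `|g x| <= 2 * `|f x|.
Proof.
pose E : set R := [set `|f x| | f in [set f : dual X | `|f| <= 1]].
have E0 : E !=set0 by exists `|(0 : dual X) x|, 0 => //=; rewrite normr0.
have Eub : has_ubound E.
  exists `|x| => _ [f /= f1 <-]; rewrite (le_trans (dual_norm_ub f x))//.
  by rewrite ler_piMl.
have gE (g : dual X) : `|g| <= 1 -> `|g x| <= sup E.
  by move=> g1; apply: ub_le_sup => //; exists g.
have [s0|s0] := leP (sup E) 0.
  exists 0; split; first by rewrite normr0.
  by move=> g /gE gs; rewrite (le_trans gs)// (le_trans s0)// mulr_ge0.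
have [|_ [f /= f1 <-] fs] := @sup_adherent _ E (sup E / 2) _ (conj E0 Eub).
  by rewrite divr_gt0.
exists f; split=> // g /gE gs; rewrite (le_trans gs)//.
by move: fs; set n := `|_|; lra.
Qed.

(** Take half norming functionals at the points [e n] of a dense sequence. If
they all vanish at [x - y], choose [e n] close to [x - y]: they are small at
[e n], hence so is every [g] of the unit ball, first at [e n] and then at
[x - y]. *)
Lemma countable_weak_separation (R : realType) (X : normedModType R) :
  separable X -> exists f : nat -> dual X, forall x y : X,
    (forall n, f n x = f n y) -> forall g : dual X, g x = g y.
Proof.
move=> /separable_dense_seq[e ed].
have /choice[f fP] := fun n => half_norming (e n).
exists f => x y fxy.
have unit_ball (g : dual X) : `|g| <= 1 -> g x = g y.
  move=> g1; apply/eqP; rewrite -subr_eq0 -linearB -normr_le0.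
  apply/ler_addgt0Pl => d d0; rewrite addr0.
  (* [d / 3] pays once for [g] and, as [f n] is only half norming, twice for
     [f n]. *)
  have d30 : 0 < d / 3 by rewrite divr_gt0.
  have [_ [n _ <-] en] := dense_norm ed (x - y) d30.
  have near (k : dual X) : `|k| <= 1 -> `|k (x - y - e n)| <= d / 3.
    move=> k1; rewrite (le_trans (dual_norm_ub k _))// (le_trans _ (ltW en))//.
    by rewrite ler_piMl.
  have -> : d = d / 3 + 2 * (d / 3).
    by lra.
  rewrite -(subrK (e n) (x - y)) linearD (le_trans (ler_normD _ _))//.
  rewrite lerD ?near// (le_trans ((fP n).2 g g1))// ler_wpM2l//.
  have := near _ (fP n).1; rewrite linearB/= linearB/= fxy subrr sub0r normrN.
  exact.
move=> g; have [g0|g0] := eqVneq `|g| 0.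
  by rewrite (dual_norm0_eq0 g0).
have : (`|g|^-1 *: g) x = (`|g|^-1 *: g) y.
  by apply: unit_ball; rewrite normrZ normfV normr_id mulVf.
by move=> /(mulfI (invr_neq0 g0)).
Qed.

(** If [g (u n)] stayed away from [g x] for infinitely many [n], an ultrafilter
concentrated on these [n] would give a weak limit point [y] of [u] at which all
[f n] take the same values as at [x], whereas [g] does not. *)
Lemma weakly_cvg_of_separating (R : realType) (X : normedModType R)
    (f : nat -> dual X) (u : X^nat) (x : X) (M : R) :
    reflexive_space X ->
    (forall y z : X, (forall n, f n y = f n z) -> forall g : dual X, g y = g z) ->
    (forall n, `|u n| <= M) ->
    (forall i, (f i (u n) : R) @[n --> \oo] --> (f i x : R)) ->
  weakly_cvg u x.
Proof.
move=> Xrefl fsep uM fx g; apply: contrapT => gx.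
have [e e0 far] : exists2 e : R, 0 < e &
    ~ \forall n \near \oo, `|g x - g (u n)| < e.
  apply: contrapT => /forall2NP near; apply: gx; apply/cvgrPdist_lt => e e0.
  by have [//|/contrapT] := near e.
pose B := [set n | ~ `|g x - g (u n)| < e].
have BF : ProperFilter (within B \oo).
  split; last exact: within_filter.
  rewrite /within/= => B0; apply: far; apply: filterS B0 => n nB.
  by apply: contrapT.
have [V [VU BV]] := ultraFilterLemma BF.
have ooV : \oo `<=` V.
  by move=> P ooP; apply: BV; rewrite /within/=; apply: filterS ooP.
have [y yP] := ultra_weak_limit Xrefl VU uM.
have fxy n : f n y = f n x.
  by apply: (cvg_unique _ (yP (f n)) (cvg_trans (cvg_app _ ooV) (fx n))).
have /cvgrPdist_lt/(_ _ e0) := yP g; rewrite (fsep _ _ fxy) => gV.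
have VB : V B by apply: BV; exact: withinT.
by have [n [gn]] := @filter_ex _ V _ _ (filterI gV VB).
Qed.

(** Let [x] be the weak limit along an ultrafilter finer than [\oo]. Each set of
the ultrafilter is infinite, so one can pick [s n >= n] at which the first [n]
separating functionals are close to their values at [x]. *)
Lemma bounded_weakly_cvg_subseq (R : realType) (X : normedModType R)
    (u : X^nat) (M : R) :
    separable X -> reflexive_space X -> (forall n, `|u n| <= M) ->
  exists (s : nat -> nat) (x : X),
    (forall n, (n <= s n)%N) /\ weakly_cvg (u \o s) x.
Proof.
move=> Xsep Xrefl uM; have [f fsep] := countable_weak_separation Xsep.
have [U [UU ooU]] := @ultraFilterLemma _ \oo _.
have [x xP] := ultra_weak_limit Xrefl UU uM.
have /choice[s sP] : forall n, exists k, (n <= k)%N /\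
    forall i : 'I_n, `|f i x - f i (u k)| < n.+1%:R^-1.
  move=> n.
  have near_i : \forall k \near U, forall i : 'I_n,
      `|f i x - f i (u k)| < n.+1%:R^-1.
    apply: filter_forall => i; have /cvgrPdist_lt := xP (f i); apply.
    by rewrite invr_gt0.
  have late : U [set k | (n <= k)%N] by apply: ooU; exact: nbhs_infty_ge.
  by have [k [kn ki]] := @filter_ex _ U _ _ (filterI late near_i); exists k.
exists s, x; split=> [n|]; first exact: (sP n).1.
apply: (weakly_cvg_of_separating Xrefl fsep) => [n|i]; first exact: uM.
apply/cvgrPdist_lt => d d0.
have /cvgrPdist_lt/(_ _ d0) := @cvg_harmonic R.
apply: filterS2 (nbhs_infty_gt i) => n ni.
rewrite sub0r normrN ger0_norm ?harmonic_ge0// => nd.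
exact: lt_trans ((sP n).2 (Ordinal ni)) nd.
Qed.

(** * Functionals bounded below and bounded families *)

Lemma dual_bounded_below (R : realType) (X : normedModType R) (g : dual X)
    (T : R) :
  (forall x, - T <= g x) -> g = 0.
Proof.
move=> gT; apply: dualP => x; apply/eqP/contraT => gx.
(* This multiple of [x] is chosen to have the value [- (T + 1)]. *)
have := gT (- ((T + 1) / g x) *: x).
by rewrite linearZ/= [_ *: _]mulNr divfK//; lra.
Qed.

Lemma dual_ge_dense (R : realType) (X : normedModType R) (g : dual X)
    (D : set X) (c : R) :
  dense D -> (forall x, D x -> c <= g x) -> forall x, c <= g x.
Proof.
move=> Dd gD x; rewrite leNgt; apply/negP => gx.
have [||y [/= gy Dy]] := Dd [set y | (g y : R) < c].
- by exists x.
- apply: (@open_comp _ _ (g : X -> R) [set z | z < c]); last exact: open_lt.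
  by move=> y _; exact: (@dual_continuous _ _ g y).
- by have := gD y Dy; rewrite leNgt gy.
Qed.

Lemma dual_cvg_uniform_bounded (R : realType) (X : completeNormedModType R)
    (F : nat -> dual X) (G : dual X) (r : R) :
  weakly_star_cvg F G ->
  exists M, forall n x, `|x| <= r -> `|F n x| <= M.
Proof.
move=> FG; pose E : set (X -> R^o) := range (fun n => F n : X -> R^o).
have [||M MP] := @Banach_Steinhauss _ _ _ E _ _ r.
- move=> _ [n _ <-]; split; last exact: dual_linear.
  move=> d; exists (`|F n| * d) => x xd.
  by rewrite (le_trans (dual_norm_ub _ _))// ler_wpM2l// dual_norm_ge0.
- move=> x; have /cvgP/cvg_seq_bounded/pinfty_ex_gt0[M _ MP] := FG x.
  by exists M => _ [n _ <-]; exact: MP.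
- by exists M => n x xr; apply: MP => //; exists n.
Qed.

(** * Existence of solutions *)

Lemma cvg_weakly_cvg (R : realType) (X : normedModType R) (u : X^nat) (x : X) :
  u @ \oo --> x -> weakly_cvg u x.
Proof. by move=> ux f; exact: (cvg_comp _ _ ux (@dual_continuous _ _ f x)). Qed.

Lemma weakly_continuous_eval (R : realType) (X : normedModType R)
    (A : X -> dual X) (v : X) :
  weakly_continuous A -> continuous (fun x => A x v : R).
Proof.
by move=> Awc; apply: seq_continuous => u x /cvg_weakly_cvg/Awc/(_ v).
Qed.

Theorem theorem2p1 (R : realType) (X : completeNormedModType R)
    (Xsep : separable X) (Xrefl : reflexive_space X)
    (A : X -> dual X) (Awc : weakly_continuous A) (Acoer : coercive A) :
  forall b : dual X, exists x : X, A x = b.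
Proof.
move=> b; have [e ed] := separable_dense_seq Xsep.
(* The slope [`|b| + 1] makes [A x x - b x] positive outside the ball. *)
have b1 : 0 < `|b| + 1 by rewrite ltr_wpDl.
have [r r0 rP] := Acoer _ b1.
have /choice[u uP] : forall n, exists x, (A x - b) x <= 0 /\
    forall i, (i < n)%N -> (A x - b) x <= (A x - b) (e i).
  move=> n; pose v (i : option 'I_n) := if i is Some j then e j else 0.
  have [|x xP] := @polytope_variational _ _ _ None v (fun x => A x - b).
    move=> i x; apply: (@cvgB _ R^o); last exact: cvg_cst.
    exact: weakly_continuous_eval.
  exists x; split=> [|i ni]; first by have := xP None; rewrite /v linear0.
  exact: (xP (Some (Ordinal ni))).
have uM n : `|u n| <= r.
  rewrite leNgt; apply/negP => ru; have := (uP n).1.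
  apply/negP; rewrite -ltNge subr_gt0.
  apply: (le_lt_trans (ler_norm _)).
  apply: (le_lt_trans (dual_norm_ub _ _)).
  apply: lt_le_trans (rP _ (ltW ru)).
  by rewrite ltr_pM2r ?ltrDl// (lt_trans r0).
have [s [x [s_ge us]]] := bounded_weakly_cvg_subseq Xsep Xrefl uM.
have AG := Awc _ _ us.
have [M MP] := dual_cvg_uniform_bounded r AG.
exists x; apply/eqP; rewrite -subr_eq0; apply/eqP.
apply: (@dual_bounded_below _ _ _ (M + `|b| * r)).
apply: (dual_ge_dense ed) => _ [i _ <-].
have cvgAb :
    ((A (u (s n)) - b) (e i) : R) @[n --> \oo] --> ((A x - b) (e i) : R).
  by apply: (@cvgB _ R^o); [exact: AG|exact: cvg_cst].
apply: (cvgr_to_ge cvgAb); apply: filterS (nbhs_infty_gt i) => n ni.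
apply: le_trans ((uP (s n)).2 i (leq_trans ni (s_ge n))).
rewrite lerNl -[X in X <= _]/(- (A (u (s n)) (u (s n)) - b (u (s n)))).
rewrite opprB addrC.
rewrite lerD//.
  by apply: le_trans (MP n _ (uM (s n))); rewrite -normrN ler_norm.
rewrite (le_trans (ler_norm _))// (le_trans (dual_norm_ub _ _))//.
by rewrite ler_wpM2l// dual_norm_ge0.
Qed.
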